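(* Let $\mathcal H$ be a complex Hilbert space of finite dimension $d\ge 2$. A context-indexed probability assignment $w$ on $\mathfrak M(\mathcal H)$ is complementary-unitary invariant if and only if, for every nonzero orthogonal projection $P$ on $\mathcal H$, there is a function $F_P$ on the integer partitions of $d-\operatorname{rank}P$ such that $$w(P,\mathsf M)=F_P\bigl(\lambda_P(\mathsf M)\bigr)\qquad(\mathsf M\in\mathfrak M_P).$$ For an invariant assignment represented in this way, context independence holds if and only if each $F_P$ is constant on the profiles that occur (i.e. on $\{\lambda_P(\mathsf M):\mathsf M\in\mathfrak M_P\}$). In particular, on maximal measurements, complementary-unitary invariance is equivalent to context independence: a context-indexed probability assignment on $\mathfrak M_1(\mathcal H)$ is complementary-unitary invariant if and only if it is context independent.
   Context: A projective measurement on $\mathcal H$ is an unordered finite family (set) $\mathsf M=\{P_1,\dots,P_m\}$ of nonzero pairwise orthogonal orthogonal projections on $\mathcal H$ with $\sum_{j=1}^m P_j=I$; it is maximal if every $P_j$ has rank one. $\mathfrak M(\mathcal H)$ is the set of all projective measurements, $\mathfrak M_1(\mathcal H)$ the set of maximal ones, and $\mathfrak M_P=\{\mathsf M\in\mathfrak M(\mathcal H):P\in\mathsf M\}$. For $P\in\mathsf M$, the complementary rank profile $\lambda_P(\mathsf M)$ is the nondecreasing tuple listing (with multiplicity) the ranks of the projections in $\mathsf M\setminus\{P\}$; it is an integer partition of $d-\operatorname{rank}P$ (empty if $P=I$). $G_P=\{U\in\mathcal U(\mathcal H):Ux=x\text{ for every }x\in\operatorname{ran}P\}$, where $\mathcal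 U(\mathcal H)$ is the unitary group, and $U\mathsf M U^*:=\{UQU^*:Q\in\mathsf M\}$. A context-indexed probability assignment on a class $\mathcal D\subseteq\mathfrak M(\mathcal H)$ is a function $w:\{(P,\mathsf M):\mathsf M\in\mathcal D,\ P\in\mathsf M\}\to[0,1]$ with $\sum_{P\in\mathsf M}w(P,\mathsf M)=1$ for every $\mathsf M\in\mathcal D$. It is context independent if $w(P,\mathsf M)=w(P,\mathsf N)$ whenever $\mathsf M,\mathsf N\in\mathcal D$ and $P\in\mathsf M\cap\mathsf N$. For $\mathcal D=\mathfrak M(\mathcal H)$ or $\mathcal D=\mathfrak M_1(\mathcal H)$, it is complementary-unitary invariant if $w(P,U\mathsf MU^* )=w(P,\mathsf M)$ for every $\mathsf M\in\mathcal D$, every $P\in\mathsf M$ and every $U\in G_P$. *)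

(* Defs.v *)
From HB Require Import structures.
From mathcomp Require Import all_boot all_order all_algebra.
From mathcomp Require Import sesquilinear finmap complex boolp reals.

Set Implicit Arguments.
Unset Strict Implicit.
Unset Printing Implicit Defensive.

Import Order.TTheory GRing.Theory Num.Theory Num.Def.

Local Open Scope ring_scope.
Local Open Scope fset_scope.

Definition is_intpart (n : nat) (s : seq nat) : bool :=
  [&& sorted leq s, 0%N \notin s & sumn s == n].

Definition intpart (n : nat) : Type := {s : seq nat | is_intpart n s}.

Section FiniteDimensionalHilbert.
Variables (R : realType) (V : vectType R[i]) (dotp : {dot V for conjC}).

Local Notation "''[' u , v ]" := (dotp u%R v%R) : ring_scope.

Lemma orthonormal_of_size (n : nat) : (n <= \dim {:V})%N ->
  exists2 X : seq V, orthonormal dotp X & size X = n.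
Proof.
elim: n => [_|n IHn ltn]; first by exists [::].
have [X oX sX] := IHn (ltnW ltn).
have [x xX] : exists x : V, x \notin <<X>>%VS.
  apply/not_existsP => h; suff /dimvS : ({:V} <= <<X>>)%VS.
    by rewrite (eqnP (orthonormal_free oX)) sX leqNgt ltn.
  by apply/subvP => x _; apply/negPn/negP; exact: h.
have [y yX [z [xE _ oz]]] := orthogonal_split dotp X x.
have z0 : z != 0.
  by apply: contra xX => /eqP z0; rewrite xE z0 addr0.
have pz : 0 < sqrtC '[z, z] by rewrite (sqrt_dnorm_gt0 dotp).
exists ((sqrtC '[z, z])^-1 *: z :: X); last by rewrite /= sX.
rewrite -cat1s orthonormal_cat oX /=; apply/andP; split.
  rewrite /orthonormal/= ?andbT; apply/eqP; rewrite (dnormZ dotp).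
  rewrite ger0_norm ?invr_ge0 ?ltW// exprVn sqrtCK mulVf//.
  by rewrite (dnorm_eq0 dotp).
apply/orthoPl => u uX; rewrite linearZl_LR/=.
by move/orthoPl: oz => /(_ u uX) ->; rewrite mulr0.
Qed.

Lemma adjoint_exists (f : 'End(V)) :
  exists g : 'End(V), forall x y : V, '[f x, y] = '[x, g y].
Proof.
have [X oX sX] := orthonormal_of_size (leqnn _).
have fX := orthonormal_free oX.
have XT : <<X>>%VS = fullv.
  by apply/eqP; rewrite eqEdim subvf/= (eqnP fX) sX.
pose g (y : V) : V := \sum_(i < size X) (dotp y (f X`_i) *: X`_i).
have glin : linear g.
  move=> a u v; rewrite /g scaler_sumr -big_split; apply: eq_bigr => i _ /=.
  by rewrite linearPl/= scalerDl scalerA.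
pose gL : {linear V -> V} :=
  HB.pack g (GRing.isLinear.Build _ _ _ _ g glin).
exists (linfun gL) => x y; rewrite lfunE/=.
have : x \in <<X>>%VS by rewrite XT memvf.
move/(@coord_span _ _ _ (in_tuple X)) => ->.
set c := coord _.
rewrite linear_sum !linear_sumlz; apply: eq_bigr => i _.
rewrite linearZ !linearZl_LR/=; congr (_ * _).
rewrite /g linear_sumr (bigD1 i)//= big1 ?addr0 => [|j ji].
  rewrite linearZr_LR/= (hermC dotp (f _) y)/= expr0 mul1r.
  have [_ /(_ X`_i X`_i)] := orthonormalP oX.
  by rewrite !mem_nth// eqxx => ->; rewrite ?mulr1.
rewrite linearZr_LR/=.
have [uX /(_ X`_i X`_j)] := orthonormalP oX.
rewrite !mem_nth// => ->//.
have -> : (X`_i == X`_j) = false by rewrite nth_uniq//; apply/negbTE; rewrite eq_sym; exact: ji.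
by rewrite mulr0.
Qed.

Definition adjoint (f : 'End(V)) : 'End(V) := sval (cid (adjoint_exists f)).

Lemma adjointP (f : 'End(V)) (x y : V) : '[f x, y] = '[x, adjoint f y].
Proof. exact: (svalP (cid (adjoint_exists f))). Qed.

Definition orthogonal_projection (P : 'End(V)) : Prop :=
  (P \o P)%VF = P /\ adjoint P = P.

Definition unitary (U : 'End(V)) : Prop :=
  (adjoint U \o U)%VF = \1%VF /\ (U \o adjoint U)%VF = \1%VF.

Definition rank (P : 'End(V)) : nat := \dim (limg P).

Definition projective_measurement (M : {fset 'End(V)}) : Prop :=
  [/\ {in M, forall P, orthogonal_projection P /\ P != 0},
      {in M &, forall P Q, P != Q -> (P \o Q)%VF = 0} &
      \sum_(P <- M) P = \1%VF].

Definition maximal_measurement (M : {fset 'End(V)}) : Prop :=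
  projective_measurement M /\ {in M, forall P, rank P = 1%N}.

Definition rank_profile (P : 'End(V)) (M : {fset 'End(V)}) : seq nat :=
  sort leq [seq rank Q | Q <- M `\ P].

Lemma rank_gt0 (P : 'End(V)) : P != 0 -> (0 < rank P)%N.
Proof.
apply: contraNltn; rewrite leqn0 dimv_eq0 => /eqP P0.
apply/eqP/lfunP => x; rewrite lfunE/=; apply/eqP.
by rewrite -memv0 -P0 memv_img ?memvf.
Qed.

Lemma sum_rank (M : {fset 'End(V)}) : projective_measurement M ->
  (\sum_(P <- M) rank P)%N = \dim {:V}.
Proof.
move=> [prM oM sM]; rewrite !big_seq_fsetE/= in sM *.
have /directv_sum_independent/directvP /= <- :
    forall us : M -> V, (forall P, true -> us P \in limg (val P)) ->
    \sum_(P : M) us P = 0 -> forall P, true -> us P = 0.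
  move=> us usP us0 P _.
  have PuP (Q : M) : val Q (us Q) = us Q.
    have /memv_imgP[x _ ->] := usP Q isT.
    by have [[+ _] _] := prM _ (valP Q) => /lfunP/(_ x); rewrite comp_lfunE.
  have := congr1 (val P) us0; rewrite linear0 linear_sum (bigD1 P)//= big1.
    by rewrite addr0 PuP.
  move=> Q QP; rewrite -PuP -comp_lfunE (oM _ _ (valP P) (valP Q)) ?lfunE//.
  by apply: contra_neq QP => /val_inj.
congr (\dim _); apply/eqP; rewrite eqEsubv subvf/=; apply/subvP => x _.
rewrite -[x]id_lfunE -sM sum_lfunE; apply: memv_sumr => P _.
by rewrite memv_img ?memvf.
Qed.

Lemma rank_profile_intpart (P : 'End(V)) (M : {fset 'End(V)}) :
  projective_measurement M -> P \in M ->
  is_intpart (\dim {:V} - rank P) (rank_profile P M).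
Proof.
move=> hM PM; apply/and3P; split.
- by apply: sort_sorted; exact: leq_total.
- rewrite mem_sort; apply/mapP => -[Q]; rewrite in_fsetD1 => /andP[_ QM] r0.
  have [prM _ _] := hM; have [_ /rank_gt0] := prM _ QM.
  by rewrite -r0.
- rewrite (perm_sumn (permEl (perm_sort _ _))) sumnE big_map -(sum_rank hM).
  by rewrite [in X in _ == X](big_fsetD1 P)//= addKn.
Qed.

Definition complementary_rank_profile (P : 'End(V)) (M : {fset 'End(V)})
    (hM : projective_measurement M) (hP : P \in M) :
    intpart (\dim {:V} - rank P) :=
  exist _ (rank_profile P M) (rank_profile_intpart hM hP).

Definition occurring_profile (P : 'End(V))
    (l : intpart (\dim {:V} - rank P)) : Prop :=
  exists (M : {fset 'End(V)}) (hM : projective_measurement M) (hP : P \in M),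
    complementary_rank_profile hM hP = l.

Definition fixing_unitary (P U : 'End(V)) : Prop :=
  unitary U /\ {in limg P, forall x : V, U x = x}.

Definition conjugate (U : 'End(V)) (M : {fset 'End(V)}) : {fset 'End(V)} :=
  [fset (U \o Q \o adjoint U)%VF | Q in M].

(* Assignments are total functions; only the values at pairs (P, M) with M in
   the class D and P in M are ever constrained or used. *)
Definition probability_assignment (D : {fset 'End(V)} -> Prop)
    (w : 'End(V) -> {fset 'End(V)} -> R) : Prop :=
  forall M, D M ->
    {in M, forall P, 0 <= w P M <= 1} /\ \sum_(P <- M) w P M = 1.

Definition context_independent (D : {fset 'End(V)} -> Prop)
    (w : 'End(V) -> {fset 'End(V)} -> R) : Prop :=
  forall M N P, D M -> D N -> P \in M -> P \in N -> w P M = w P N.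

Definition complementary_unitary_invariant (D : {fset 'End(V)} -> Prop)
    (w : 'End(V) -> {fset 'End(V)} -> R) : Prop :=
  forall M P U, D M -> P \in M -> fixing_unitary P U ->
    w P (conjugate U M) = w P M.

Definition represents (P : 'End(V)) (F : intpart (\dim {:V} - rank P) -> R)
    (w : 'End(V) -> {fset 'End(V)} -> R) : Prop :=
  forall (M : {fset 'End(V)}) (hM : projective_measurement M) (hP : P \in M),
    w P M = F (complementary_rank_profile hM hP).

End FiniteDimensionalHilbert.

(* Main.v *)
(* Two measurements containing P have the same complementary rank profile iff
   some U in G_P carries one to the other. Hence invariance says that w(P, M)
   depends on M only through the profile of P in M. A maximal measurement has
   profile (1, ..., 1) at each of its elements, so there the profile carries no
   information and invariance becomes context independence. *)
From HB Require Import structures.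
Require Import Defs.
From mathcomp Require Import all_boot all_order all_algebra.
From mathcomp Require Import sesquilinear finmap complex boolp reals.

Set Implicit Arguments.
Unset Strict Implicit.
Unset Printing Implicit Defensive.

Import Order.TTheory GRing.Theory Num.Theory Num.Def.

Local Open Scope ring_scope.
Local Open Scope fset_scope.

Section Hilbert.
Variables (R : realType) (V : vectType R[i]) (dotp : {dot V for conjC}).
Implicit Types (f g P Q U W : 'End(V)) (M N : {fset 'End(V)}) (X Y Z : seq V).

Local Notation adj := (adjoint dotp).

(** * Adjoint calculus *)

Lemma dot_inj (u v : V) : (forall x, dotp x u = dotp x v) -> u = v.
Proof.
move=> h; apply/eqP; rewrite -subr_eq0 -(dnorm_eq0 dotp).
by rewrite linearBr /= h subrr.
Qed.

Lemma adjoint_unique f g :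
  (forall x y, dotp (f x) y = dotp x (g y)) -> adj f = g.
Proof. by move=> h; apply/lfunP => y; apply: dot_inj => x; rewrite -adjointP. Qed.

Lemma dot_conj (u v : V) : dotp u v = (dotp v u)^*.
Proof. by rewrite (hermC dotp u v)/= expr0 mul1r. Qed.

Lemma adjointK f : adj (adj f) = f.
Proof.
by apply: adjoint_unique => x y; rewrite dot_conj -adjointP [RHS]dot_conj.
Qed.

Lemma adjoint_comp f g : adj (f \o g)%VF = (adj g \o adj f)%VF.
Proof. by apply: adjoint_unique => x y; rewrite !comp_lfunE !adjointP. Qed.

Lemma adjoint_sum n (f : 'I_n -> 'End(V)) :
  adj (\sum_i f i) = \sum_i adj (f i).
Proof.
apply: adjoint_unique => x y; rewrite !sum_lfunE linear_sumr linear_sumlz.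
by apply: eq_bigr => i _; rewrite /= adjointP.
Qed.

Lemma comp_lfun_suml n (f : 'I_n -> 'End(V)) g :
  ((\sum_i f i) \o g)%VF = \sum_i (f i \o g)%VF.
Proof.
apply/lfunP => x; rewrite comp_lfunE !sum_lfunE.
by under [RHS]eq_bigr do rewrite comp_lfunE.
Qed.

Lemma comp_lfun_sumr n (f : 'I_n -> 'End(V)) g :
  (g \o (\sum_i f i))%VF = \sum_i (g \o f i)%VF.
Proof.
apply/lfunP => x; rewrite comp_lfunE !sum_lfunE linear_sum.
by under [RHS]eq_bigr do rewrite comp_lfunE.
Qed.

(** * Orthonormal bases of subspaces and partial isometries *)

Lemma ex_orthonormal_basis (S : {vspace V}) :
  exists2 X, orthonormal dotp X & <<X>>%VS = S.
Proof.
suff [X oX [sX XS]] : exists2 X, orthonormal dotp X &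
    size X = \dim S /\ (<<X>> <= S)%VS.
  exists X => //; apply/eqP.
  by rewrite eqEdim XS (eqnP (orthonormal_free oX)) sX leqnn.
(* Gram-Schmidt inside [S]: the induction builds orthonormal lists of every length n <= [\dim S],
   and length [\dim S] forces the span to be [S]. *)
elim: {-2}(\dim S) (leqnn (\dim S)) => [|n IHn ltn].
  by exists [::]; rewrite // span_nil sub0v.
have [X oX [sX XS]] := IHn (ltnW ltn).
have /subvPn[x xS xX] : ~~ (S <= <<X>>)%VS.
  by apply: contraTN ltn => /dimvS; rewrite (eqnP (orthonormal_free oX)) sX -leqNgt.
have [y yX [z [xE _ oz]]] := orthogonal_split dotp X x.
have z0 : z != 0 by apply: contra xX => /eqP z0; rewrite xE z0 addr0.
exists ((sqrtC (dotp z z))^-1 *: z :: X); last first.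
  rewrite /= sX; split=> //; rewrite -cat1s span_cat subv_add XS andbT.
  rewrite span_seq1 -memvE memvZ //.
  by rewrite -[z](addKr y) addrC -xE memvB // (subvP XS).
have pz : 0 < sqrtC (dotp z z) by rewrite (sqrt_dnorm_gt0 dotp).
rewrite -cat1s orthonormal_cat oX /=; apply/andP; split.
  rewrite /orthonormal/= ?andbT; apply/eqP; rewrite (dnormZ dotp).
  rewrite ger0_norm ?invr_ge0 ?ltW// exprVn sqrtCK mulVf//.
  by rewrite (dnorm_eq0 dotp).
apply/orthoPl => u uX; rewrite linearZl_LR/=.
by move/orthoPl: oz => /(_ u uX) ->; rewrite mulr0.
Qed.

(** The operator written sum_i |Y_i><X_i| in physics: for [X] orthonormal it sends X_i to Y_i and
    kills the orthogonal complement of the span of [X]. *)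
Definition transfer_fun X Y (x : V) : V :=
  \sum_(i < size X) dotp x X`_i *: Y`_i.

Fact transfer_fun_linear X Y : linear (transfer_fun X Y).
Proof.
move=> a u v; rewrite scaler_sumr -big_split; apply: eq_bigr => i _ /=.
by rewrite linearPl/= scalerDl scalerA.
Qed.

HB.instance Definition _ X Y :=
  GRing.isLinear.Build _ _ _ _ (transfer_fun X Y) (transfer_fun_linear X Y).

Definition transfer X Y : 'End(V) := linfun (transfer_fun X Y).

Lemma transferE X Y x :
  transfer X Y x = \sum_(i < size X) dotp x X`_i *: Y`_i.
Proof. exact: lfunE. Qed.

Lemma adjoint_transfer X Y : size X = size Y ->
  adj (transfer X Y) = transfer Y X.
Proof.
move=> sXY; apply: adjoint_unique => x y; rewrite !transferE -sXY.
rewrite linear_sumr linear_sumlz; apply: eq_bigr => i _.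
by rewrite linearZl_LR linearZr_LR /= mulrC -dot_conj.
Qed.

Lemma orthonormal_nth X i j : orthonormal dotp X ->
  (i < size X)%N -> (j < size X)%N -> dotp X`_i X`_j = (i == j)%:R.
Proof.
by case/orthonormalP=> uX oX ltiX ltjX; rewrite oX ?mem_nth // nth_uniq.
Qed.

(** Orthonormality of the middle list alone collapses the double sum to its diagonal. *)
Lemma transfer_comp X Y Z : size X = size Y -> orthonormal dotp Y ->
  (transfer Y Z \o transfer X Y)%VF = transfer X Z.
Proof.
move=> sXY oY; apply/lfunP => x; rewrite comp_lfunE !transferE -sXY.
apply: eq_bigr => i _; congr (_ *: _).
rewrite linear_sumlz (bigD1 i) //= linearZl_LR /= orthonormal_nth -?sXY //.
rewrite eqxx mulr1 big1 ?addr0 // => j ji.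
by rewrite linearZl_LR /= orthonormal_nth -?sXY // [_ == _](negPf ji) mulr0.
Qed.

Lemma orthogonal_projection_id P : orthogonal_projection dotp P ->
  {in limg P, forall x, P x = x}.
Proof. by case=> PP _ _ /memv_imgP[x _ ->]; rewrite -comp_lfunE PP. Qed.

Lemma transfer_id X P : orthonormal dotp X -> orthogonal_projection dotp P ->
  <<X>>%VS = limg P -> transfer X X = P.
Proof.
move=> oX hP XP; apply/lfunP => x.
(* [P] is self-adjoint and fixes every vector of [X], so x and P x have the same coefficients; it
   remains to expand P x in [X]. *)
have <- : transfer X X (P x) = transfer X X x.
  rewrite !transferE; apply: eq_bigr => i _; congr (_ *: _).
  have [_ aP] := hP; rewrite adjointP aP orthogonal_projection_id // -XP.
  by rewrite memv_span // mem_nth.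
have : P x \in <<X>>%VS by rewrite XP memv_img ?memvf.
move/(@coord_span _ _ _ (in_tuple X)) => {1 2}->.
rewrite linear_sum; apply: eq_bigr => i _; rewrite linearZ; congr (_ *: _).
rewrite /= transferE (bigD1 i) //= orthonormal_nth // eqxx scale1r.
by rewrite big1 ?addr0 // => j ji;
   rewrite orthonormal_nth // eq_sym [_ == _](negPf ji) scale0r.
Qed.

(** Equal ranks give orthonormal bases of the two ranges of the same length. [W] carries one to the
    other, and all four identities are compositions of transfers. *)
Lemma ex_partial_isometry P Q :
    orthogonal_projection dotp P -> orthogonal_projection dotp Q ->
    rank P = rank Q ->
  exists W, [/\ (adj W \o W)%VF = P, (W \o adj W)%VF = Q,
    (W \o P)%VF = W & (Q \o W)%VF = W].
Proof.
move=> hP hQ rPQ.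
have [X oX XP] := ex_orthonormal_basis (limg P).
have [Y oY YQ] := ex_orthonormal_basis (limg Q).
have sXY : size X = size Y.
  by rewrite -(eqnP (orthonormal_free oX)) -(eqnP (orthonormal_free oY)) XP YQ.
exists (transfer X Y); rewrite adjoint_transfer //.
rewrite -(transfer_id oX hP XP) -(transfer_id oY hQ YQ).
by rewrite !transfer_comp.
Qed.

(** * Conjugation by unitaries, and its transitivity on measurements with equal profiles *)

Definition conj_by U f : 'End(V) := (U \o f \o adj U)%VF.

(** Expanding both products, the cross terms vanish and the diagonal sums to the identity. *)
Lemma unitary_sum n (W : 'I_n -> 'End(V)) :
    \sum_i (adj (W i) \o W i)%VF = \1%VF ->
    \sum_i (W i \o adj (W i))%VF = \1%VF ->
    (forall i j, i != j -> (adj (W i) \o W j)%VF = 0) ->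
    (forall i j, i != j -> (W i \o adj (W j))%VF = 0) ->
  unitary dotp (\sum_i W i).
Proof.
move=> s1 s2 o1 o2; rewrite /unitary adjoint_sum !comp_lfun_suml.
rewrite -[in RHS]s1 -[in X in _ /\ _ = X]s2.
split; apply: eq_bigr => i _; rewrite comp_lfun_sumr (bigD1 i) //= big1 ?addr0 //.
  by move=> j ji; rewrite o1 // eq_sym.
by move=> j ji; rewrite o2 // eq_sym.
Qed.

Lemma rank_conj_le f g : (rank (f \o g \o adj f)%VF <= rank g)%N.
Proof.
rewrite /rank !limg_comp (leq_trans (_ : _ <= \dim (g @: (adj f @: fullv)))%N) //.
  by rewrite -[leqRHS](limg_ker_dim f) leq_addl.
by rewrite dimvS // limgS // subvf.
Qed.

Section Conjugation.
Variable U : 'End(V).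
Hypothesis uU : unitary dotp U.

Lemma conj_byK : cancel (conj_by U) (conj_by (adj U)).
Proof.
move=> f; case: uU => aU _; rewrite /conj_by adjointK !comp_lfunA aU comp_lfun1l.
by rewrite -comp_lfunA aU comp_lfun1r.
Qed.

Lemma conj_by_comp f g : conj_by U (f \o g)%VF = (conj_by U f \o conj_by U g)%VF.
Proof.
case: uU => aU _; rewrite /conj_by !comp_lfunA; congr (_ \o _)%VF.
by rewrite -[in RHS](comp_lfunA _ _ U) aU comp_lfun1r.
Qed.

Lemma conj_by0 : conj_by U 0 = 0.
Proof. by rewrite /conj_by comp_lfun0r comp_lfun0l. Qed.

Lemma orthogonal_projection_conj P :
  orthogonal_projection dotp P -> orthogonal_projection dotp (conj_by U P).
Proof.
case=> PP aP; split; first by rewrite -conj_by_comp PP.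
by rewrite /conj_by !adjoint_comp adjointK aP comp_lfunA.
Qed.

Lemma projective_measurement_conj M : projective_measurement dotp M ->
  projective_measurement dotp (conjugate dotp U M).
Proof.
case=> prM oM sM; split.
- move=> _ /imfsetP[/= Q QM ->]; have [oQ Q0] := prM _ QM.
  split; first exact: orthogonal_projection_conj.
  by apply: contra_neq Q0 => Q0; rewrite -[Q]conj_byK /conj_by Q0 comp_lfun0r comp_lfun0l.
- move=> _ _ /imfsetP[/= P PM ->] /imfsetP[/= Q QM ->] PQ.
  rewrite -!/(conj_by U _) -conj_by_comp oM ?conj_by0 //.
  by apply: contra_neq PQ => ->.
- rewrite big_imfset => [|P Q _ _]; last exact: (can_inj conj_byK).
  case: uU => _ <-; rewrite -[X in (X \o _)%VF]comp_lfun1r -sM /=.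
  apply/lfunP => x; rewrite sum_lfunE !comp_lfunE sum_lfunE linear_sum.
  by apply: eq_bigr => Q _; rewrite !comp_lfunE.
Qed.

End Conjugation.

(** Conjugation cannot raise the rank, and conjugation by the adjoint undoes it. *)
Lemma rank_conj U f : unitary dotp U -> rank (conj_by U f) = rank f.
Proof.
move=> uU; apply/eqP; rewrite eqn_leq rank_conj_le /=.
by rewrite -{1}[f](conj_byK uU) rank_conj_le.
Qed.

(** Fixing ran P pointwise means U P = P; taking adjoints gives P U^* = P. *)
Lemma conj_by_fixing P U : orthogonal_projection dotp P ->
  fixing_unitary dotp P U -> conj_by U P = P.
Proof.
move=> [PP aP] [_ fU].
have UP : (U \o P)%VF = P.
  by apply/lfunP => x; rewrite comp_lfunE fU // memv_img ?memvf.
by rewrite /conj_by UP -[in LHS]aP -adjoint_comp UP.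
Qed.

Lemma mem_conjugate_fixing P U M : orthogonal_projection dotp P ->
  fixing_unitary dotp P U -> P \in M -> P \in conjugate dotp U M.
Proof.
by move=> oP fU PM; rewrite -(conj_by_fixing oP fU); apply/imfsetP; exists P.
Qed.

(** Conjugation is injective, fixes [P] and preserves ranks, so it maps the complement of [P] in [M]
    bijectively onto the complement of [P] in the conjugate. *)
Lemma rank_profile_conjugate P U M : orthogonal_projection dotp P ->
  fixing_unitary dotp P U ->
  rank_profile P (conjugate dotp U M) = rank_profile P M.
Proof.
move=> oP fU; rewrite /rank_profile; have [uU _] := fU; have inj := can_inj (conj_byK uU).
have -> : conjugate dotp U M `\ P = conjugate dotp U (M `\ P).
  apply/fsetP => Q; rewrite in_fsetD1; apply/andP/imfsetP => /=.
    move=> [QP /imfsetP[/= Q' Q'M QE]]; exists Q' => //.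
    rewrite in_fsetD1 Q'M andbT; apply: contra_neq QP => Q'P.
    by rewrite QE Q'P -[RHS](conj_by_fixing oP fU).
  move=> [Q' /[!in_fsetD1]/andP[Q'P Q'M] ->]; split; last by apply/imfsetP; exists Q'.
  by apply: contra_neq Q'P => Q'P; apply: inj; rewrite (conj_by_fixing oP fU).
apply/perm_sortP; [exact: leq_total | exact: leq_trans | exact: anti_leq |].
rewrite (perm_trans (perm_map _ (enum_imfset _ _))) //; first by move=> ? ? _ _ /inj.
by rewrite -map_comp (eq_map (fun f => rank_conj f uU)).
Qed.

(* Sorting M \ {P} and N \ {P} by rank pairs projections of equal rank; U is the
   sum of partial isometries between the ranges of the pairs, with P paired to
   itself by the partial isometry P. *)
Lemma ex_fixing_unitary P M N :
    projective_measurement dotp M -> projective_measurement dotp N ->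
    P \in M -> P \in N -> rank_profile P M = rank_profile P N ->
  exists2 U, fixing_unitary dotp P U & conjugate dotp U M = N.
Proof.
move=> hM hN PM PN rMN.
(* The projections themselves are sorted, by rank, with [P] placed at index 0. *)
pose enumP M' := P :: sort (relpre (@rank _ V) leq) (M' `\ P).
have enumP_mem M' : P \in M' -> enumP M' =i M'.
  move=> PM' Q; rewrite inE mem_sort in_fsetD1; case: eqVneq => [->|//].
  by rewrite PM'.
have enumP_uniq M' : uniq (enumP M').
  by rewrite /= mem_sort in_fsetD1 eqxx sort_uniq fset_uniq.
set s := enumP M; set t := enumP N.
have rst : map (@rank _ V) s = map (@rank _ V) t.
  by rewrite /= -!sort_map; congr (_ :: _).
have sst : size s = size t by rewrite -(size_map (@rank _ V)) rst size_map.
have [prM oM sM] := hM; have [prN oN sN] := hN.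
have sE (i : 'I_(size s)) : s`_i \in M by rewrite -enumP_mem ?mem_nth.
have tE (i : 'I_(size s)) : t`_i \in N by rewrite -enumP_mem ?mem_nth -?sst.
(* The last clause pins the isometry at index 0 to [P]: an arbitrary one would preserve ran P
   without fixing its vectors. *)
have exW (i : 'I_(size s)) : exists W, [/\ (adj W \o W)%VF = s`_i,
    (W \o adj W)%VF = t`_i, (W \o s`_i)%VF = W, (t`_i \o W)%VF = W &
    i = 0%N :> nat -> W = P].
  have [i0|i0] := eqVneq (i : nat) 0%N.
    by exists P; have [[PP aP] _] := prM _ PM; rewrite i0 /= aP PP.
  have [] := @ex_partial_isometry s`_i t`_i.
  - by case: (prM _ (sE i)).
  - by case: (prN _ (tE i)).
  - by rewrite -!(nth_map 0 0%N) -?sst // rst.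
  by move=> W [? ? ? ?]; exists W; split=> // /eqP; rewrite (negPf i0).
have [W hW] := boolp.choice exW.
have os (i j : 'I_(size s)) : i != j -> (s`_i \o s`_j)%VF = 0.
  by move=> ij; rewrite oM ?sE // nth_uniq ?enumP_uniq.
have ot (i j : 'I_(size s)) : i != j -> (t`_i \o t`_j)%VF = 0.
  by move=> ij; rewrite oN ?tE // nth_uniq ?enumP_uniq -?sst.
have sum_enumP M' : P \in M' ->
    \sum_(i < size (enumP M')) (enumP M')`_i = \sum_(Q <- M') Q.
  move=> PM'; transitivity (\sum_(Q <- enumP M') Q).
    by rewrite [RHS](big_nth 0) big_mkord.
  by apply: perm_big; rewrite uniq_perm ?enumP_uniq ?fset_uniq // => Q; rewrite enumP_mem.
have s1 : \sum_(i < size s) s`_i = \1%VF by rewrite sum_enumP.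
have t1 : \sum_(i < size s) t`_i = \1%VF by rewrite sst sum_enumP.
(* Since W_i = W_i s_i, every term with i != j is killed by s_j. *)
have WsW (j : 'I_(size s)) : ((\sum_i W i) \o s`_j)%VF = W j.
  have [_ _ Wj _ _] := hW j.
  rewrite comp_lfun_suml (bigD1 j) //= Wj big1 ?addr0 // => i ij.
  by have [_ _ <- _ _] := hW i; rewrite -comp_lfunA os ?comp_lfun0r.
(* With s_j a self-adjoint idempotent, U s_j U^* = (U s_j)(U s_j)^* = W_j W_j^* = t_j. *)
have cU (j : 'I_(size s)) : conj_by (\sum_i W i) s`_j = t`_j.
  have [[ss aj] _] := prM _ (sE j).
  by rewrite /conj_by -{1}ss comp_lfunA WsW -{1}aj -comp_lfunA -adjoint_comp WsW;
     case: (hW j).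
exists (\sum_i W i); first split.
- apply: unitary_sum.
  + by rewrite -s1; apply: eq_bigr => i _; case: (hW i).
  + by rewrite -t1; apply: eq_bigr => i _; case: (hW i).
  (* W_i^* W_j contains the factor t_i t_j = 0; in the next case W_i W_j^* contains s_i s_j = 0. *)
  + move=> i j ij; have [_ _ _ <- _] := hW i; have [_ _ _ <- _] := hW j.
    rewrite adjoint_comp; have [[_ ->] _] := prN _ (tE i).
    by rewrite comp_lfunA -[(_ \o t`_i \o _)%VF]comp_lfunA ot // comp_lfun0r comp_lfun0l.
  + move=> i j ij; have [_ _ <- _ _] := hW i; have [_ _ <- _ _] := hW j.
    rewrite adjoint_comp; have [[_ ->] _] := prM _ (sE j).
    by rewrite comp_lfunA -[(_ \o s`_i \o _)%VF]comp_lfunA os // comp_lfun0r comp_lfun0l.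
- move=> _ /memv_imgP[x _ ->]; rewrite -comp_lfunE.
  (* At index 0 this reads U P = W_0 = P. *)
  by have := WsW ord0; have [_ _ _ _ ->] := hW ord0; rewrite //= => ->.
apply/fsetP => Q; apply/imfsetP/idP => /= [[Q' + ->]|].
  rewrite -(enumP_mem _ PM) => /(nthP 0)[i lti <-].
  by rewrite -/(conj_by _ _) (cU (Ordinal lti)) -(enumP_mem _ PN) mem_nth // -sst.
rewrite -(enumP_mem _ PN) => /(nthP 0)[i + <-]; rewrite -sst => lti.
by exists s`_i; rewrite -?(cU (Ordinal lti)) // -(enumP_mem _ PM) mem_nth.
Qed.

(** * Profiles and invariant assignments *)

Lemma complementary_rank_profile_eq P M N (hM : projective_measurement dotp M)
    (hN : projective_measurement dotp N) (PM : P \in M) (PN : P \in N) :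
  rank_profile P M = rank_profile P N ->
  complementary_rank_profile hM PM = complementary_rank_profile hN PN.
Proof. by move=> e; apply: val_inj. Qed.

(** All parts equal 1 and their sum is known, which determines their number. *)
Lemma rank_profile_maximal P M : maximal_measurement dotp M -> P \in M ->
  rank_profile P M = nseq (\dim {:V} - rank P) 1%N.
Proof.
move=> [hM r1] PM; have /and3P[_ _ /eqP sE] := rank_profile_intpart hM PM.
have /all_pred1P e : all (pred1 1%N) (rank_profile P M).
  apply/allP => r; rewrite mem_sort => /mapP[Q].
  by rewrite in_fsetD1 => /andP[_ QM] ->; rewrite /= r1.
by rewrite -sE {2}e sumn_nseq mul1n.
Qed.

Lemma maximal_measurement_conj U M : unitary dotp U ->
  maximal_measurement dotp M -> maximal_measurement dotp (conjugate dotp U M).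
Proof.
move=> uU [hM r1]; split; first exact: projective_measurement_conj.
by move=> _ /imfsetP[/= Q QM ->]; rewrite -/(conj_by U Q) rank_conj // r1.
Qed.

(** Some unitary in G_P carries [M] to [N]. The class [D] stays abstract to cover both all
    measurements and the maximal ones. *)
Lemma invariant_profile_eq (D : {fset 'End(V)} -> Prop)
    (w : 'End(V) -> {fset 'End(V)} -> R) P M N :
    (forall M, D M -> projective_measurement dotp M) ->
    complementary_unitary_invariant dotp D w -> D M -> D N ->
    P \in M -> P \in N -> rank_profile P M = rank_profile P N ->
  w P M = w P N.
Proof.
move=> DE inv DM DN PM PN e.
have [U fU <-] := ex_fixing_unitary (DE _ DM) (DE _ DN) PM PN e.
by rewrite inv.
Qed.

End Hilbert.

Theorem theorem4p3 (R : realType) (V : vectType R[i]) (dotp : {dot V for conjC})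
    (hd : (2 <= \dim {:V})%N) :
  (forall w : 'End(V) -> {fset 'End(V)} -> R,
    probability_assignment (projective_measurement dotp) w ->
    (complementary_unitary_invariant dotp (projective_measurement dotp) w <->
     forall P : 'End(V), orthogonal_projection dotp P -> P != 0 ->
       exists F : intpart (\dim {:V} - rank P) -> R, represents dotp F w))
  /\
  (forall (w : 'End(V) -> {fset 'End(V)} -> R)
          (F : forall P : 'End(V), intpart (\dim {:V} - rank P) -> R),
    probability_assignment (projective_measurement dotp) w ->
    complementary_unitary_invariant dotp (projective_measurement dotp) w ->
    (forall P : 'End(V), orthogonal_projection dotp P -> P != 0 ->
       represents dotp (F P) w) ->
    (context_independent (projective_measurement dotp) w <->
     forall P : 'End(V), orthogonal_projection dotp P -> P != 0 ->
       forall l m : intpart (\dim {:V} - rank P),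
         occurring_profile dotp l -> occurring_profile dotp m ->
         F P l = F P m))
  /\
  (forall w : 'End(V) -> {fset 'End(V)} -> R,
    probability_assignment (maximal_measurement dotp) w ->
    (complementary_unitary_invariant dotp (maximal_measurement dotp) w <->
     context_independent (maximal_measurement dotp) w)).
Proof.
split; [|split].
- move=> w _; split=> [inv P oP P0|repw M P U hM PM fU].
    (* F_P(l) is the weight of [P] in a chosen measurement with profile l, or 0 if there is none; by
       invariance the choice does not matter. *)
    exists (fun l => if pselect (exists M, projective_measurement dotp M /\
        P \in M /\ rank_profile P M = val l) is left e
      then w P (projT1 (cid e)) else 0) => M hM PM.
    case: pselect => [e|[]]; last by exists M.
    case: (cid e) => N /= [hN [PN eN]].
    by apply: (invariant_profile_eq _ inv).
  have [prM _ _] := hM; have [oP P0] := prM _ PM; have [F repF] := repw P oP P0.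
  have [uU _] := fU.
  rewrite (repF _ hM PM) (repF _ (projective_measurement_conj uU hM)
    (mem_conjugate_fixing oP fU PM)).
  (* Conversely, conjugation by an element of G_P leaves the profile at [P] unchanged. *)
  by congr (F _); apply: complementary_rank_profile_eq; rewrite rank_profile_conjugate.
- move=> w F _ inv repF; split=> [ci P oP P0 l m [M [hM [PM <-]]] [N [hN [PN <-]]]|].
    by rewrite -!repF //; apply: ci.
  move=> cF M N P hM hN PM PN; have [/(_ _ PM)[oP P0] _ _] := hM.
  rewrite (repF _ oP P0 _ hM PM) (repF _ oP P0 _ hN PN).
  (* [M] and [N] themselves witness that their profiles occur. *)
  by apply: cF => //; [exists M, hM, PM | exists N, hN, PN].
- move=> w _; split=> [inv M N P hM hN PM PN|ci M P U hM PM fU].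
    apply: (invariant_profile_eq _ inv) => //; first by move=> ? [].
    (* Both profiles are the all-ones list of the same length. *)
    by rewrite !(@rank_profile_maximal _ _ dotp).
  have [[/(_ _ PM)[oP _] _ _] _] := hM; have [uU _] := fU.
  (* The conjugate is again a maximal measurement containing [P], so context independence compares
     it with [M]. *)
  apply: ci => //; first exact: maximal_measurement_conj.
  exact: mem_conjugate_fixing.
Qed.
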